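(* Let $G=K_{n_1,n_2,\dots,n_k}$ be a complete $k$-partite graph of order $n=n_1+\cdots+n_k$, where $k\geq 2$ and $n_1\leq n_2\leq\cdots\leq n_k$. Then $\mathrm{srd}(G)=n-n_2$ if $n_1=1$, and $\mathrm{srd}(G)=n-n_1$ if $n_1\geq 2$.
   Context: $K_{n_1,\dots,n_k}$ is the complete $k$-partite graph with parts of sizes $n_1,\dots,n_k$ (two vertices are adjacent iff they lie in different parts). An edge-coloring of $G$ is any map $c:E(G)\to[k']$ (adjacent edges may receive the same color). For distinct vertices $u,v$ of a connected graph $G$, a $u$-$v$-edge-cut is a set $F$ of edges such that $u$ and $v$ lie in different components of $G-F$; a minimum $u$-$v$-edge-cut is one of minimum size among these. A set of edges is rainbow if no two of its edges have the same color. An edge-colored connected graph is strong rainbow disconnected if for every two distinct vertices $u,v$ there is a $u$-$v$-edge-cut that is both rainbow and minimum; $\mathrm{srd}(G)$ is the smallest number of colors of an edge-coloring making $G$ strong rainbow disconnected. *)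

(* Defs.v *)
From mathcomp Require Import all_boot.
Set Implicit Arguments.
Unset Strict Implicit.
Unset Printing Implicit Defensive.

Record sgraph := SGraph {
  svertex :> finType;
  adj : rel svertex;
  adj_sym : symmetric adj;
  adj_irr : irreflexive adj }.

Section EdgeCuts.

Variable G : sgraph.
Implicit Types (u v : G).

Definition edge_set : {set {set G}} :=
  [set [set p.1; p.2] | p in [pred p : G * G | adj p.1 p.2]].

Definition edge := {f : {set G} | f \in edge_set}.

(* adjacency in G - F *)
Definition del_adj (F : {set edge}) : rel G :=
  fun u v => adj u v && ([set u; v] \notin [set val f | f in F]).

Definition edge_cut u v (F : {set edge}) : bool :=
  ~~ connect (del_adj F) u v.

Definition min_edge_cut u v (F : {set edge}) : bool :=
  edge_cut u v F && [forall F', edge_cut u v F' ==> (#|F| <= #|F'|)].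

Definition rainbow q (c : {ffun edge -> 'I_q}) (F : {set edge}) : bool :=
  [forall f in F, forall g in F, (f != g) ==> (c f != c g)].

Definition strong_rainbow_disconnected q (c : {ffun edge -> 'I_q}) : bool :=
  [forall u, forall v, (u != v) ==>
    [exists F, min_edge_cut u v F && rainbow c F]].

Definition srd_colorable q : bool :=
  [exists c : {ffun edge -> 'I_q}, strong_rainbow_disconnected c].

Lemma edge_cut_setT u v : u != v -> edge_cut u v setT.
Proof.
move=> uv; apply/negP => /connectP [[|w p] /=]; first by move=> _ e; rewrite e eqxx in uv.
case/andP=> /andP [uw] /negP + _ _; apply.
have hf : [set u; w] \in edge_set by apply/imsetP; exists (u, w).
by apply/imsetP; exists (Sub [set u; w] hf : edge); rewrite ?inE.
Qed.

Lemma srd_colorable_ex : exists q, srd_colorable q.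
Proof.
exists #|{: edge}|; apply/existsP; exists [ffun f => enum_rank f].
apply/forallP=> u; apply/forallP=> v; apply/implyP=> uv.
have [F cF mF] := arg_minnP (fun F : {set edge} => #|F|) (edge_cut_setT uv).
apply/existsP; exists F; rewrite /min_edge_cut cF /=; apply/andP; split.
  by apply/forallP=> F'; apply/implyP=> /mF.
apply/forall_inP=> f _; apply/forall_inP=> g _; apply/implyP.
by rewrite !ffunE (inj_eq enum_rank_inj).
Qed.

(* srd is usually defined for connected graphs only; the definition makes sense
   for every finite graph and is not restricted here. *)
Definition srd : nat := ex_minn srd_colorable_ex.

End EdgeCuts.

Section CompleteMultipartite.

Variables (k : nat) (n : 'I_k -> nat).

(* The pair (i; x) is the x-th vertex of the i-th part. *)
Definition multipartite_vertex : finType := {i : 'I_k & 'I_(n i)}.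

Definition multipartite_adj : rel multipartite_vertex :=
  fun u v => tag u != tag v.

Fact multipartite_adj_sym : symmetric multipartite_adj.
Proof. by move=> u v; rewrite /multipartite_adj eq_sym. Qed.

Fact multipartite_adj_irr : irreflexive multipartite_adj.
Proof. by move=> u; rewrite /multipartite_adj eqxx. Qed.

Definition complete_multipartite : sgraph :=
  SGraph multipartite_adj_sym multipartite_adj_irr.

Lemma complete_multipartite_connected :
  1 < k -> (forall i, 0 < n i) ->
  forall u v : complete_multipartite, connect (@adj complete_multipartite) u v.
Proof.
move=> hk hn u v; case: (boolP (adj u v)) => [/connect1 //|].
rewrite /= /multipartite_adj negbK => /eqP uv.
have [j ju] : exists j, j != tag u.
  case: (eqVneq (Ordinal hk) (tag u)) => [<-|ne]; last by exists (Ordinal hk).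
  by exists (Ordinal (ltnW hk)).
pose w : complete_multipartite := Tagged (fun i => 'I_(n i)) (Ordinal (hn j)).
apply: (@connect_trans _ _ w); apply: connect1; rewrite /= /multipartite_adj /=.
  by rewrite eq_sym.
by rewrite -uv.
Qed.

End CompleteMultipartite.

(* Main.v *)
Require Import Defs.
From mathcomp Require Import all_boot perm zify.

(** In a complete multipartite graph a cut separating [u] and [v] has at least
    [min (deg u) (deg v)] edges, so the star of the vertex of smaller degree is a
    minimum cut. This gives the lower bound, taking two vertices of the smallest
    part if [n1 >= 2], and one vertex in each of the two smallest parts if
    [n1 = 1]. Conversely, for [x] in the smallest part, a colouring which is proper
    at every vertex except [x] is enough. Such a colouring comes from a proper
    colouring of [G - x]: a neighbour [v] of [x] has degree less than the number
    [q] of colours in [G - x], so some colour is missing at [v] and can be given to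
    [xv]. The graph [G - x] has maximum degree at most [q], and its vertices of
    degree [q] all lie in the smallest part, hence are independent; for such graphs
    Vizing's argument yields a proper [q]-edge-colouring. *)

(** * Edge colourings *)

Section InvolutionPair.
Set Implicit Arguments.
Unset Strict Implicit.

Variables (V : finType) (s t : V -> V) (x : V).
Hypotheses (sK : involutive s) (tK : involutive t) (sx : s x = x).

Let r := s \o t.
Let r_inj : injective r.
Proof. by apply: inj_comp; apply: inv_inj. Qed.

(** Since [s \o r = t], one has [r \o s \o r = s]: conjugation by [s] inverts [r]. *)
Let s_iter i : r (s (iter i.+1 r x)) = s (iter i r x).
Proof. by rewrite iterS /r /= sK tK. Qed.

Let iter_s i : iter i r (s (iter i r x)) = x.
Proof. by elim: i => [|i IH]; rewrite /= ?sx // -iterS iterSr s_iter IH. Qed.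

Let t_iter i : iter i.+1 r (t (iter i r x)) = x.
Proof. by rewrite iterSr /r /= tK; exact: iter_s. Qed.

Let fconnect_of_iter y i : iter i r y = x -> fconnect r x y.
Proof. by move=> <-; rewrite (fconnect_sym r_inj) fconnect_iter. Qed.

(** For [s] and [t] given by two colours, this is the Kempe chain of [x]. As [s] fixes [x], the
    orbit under [s \o t] alone is already closed under both. *)
Definition alt_orbit := [set y | fconnect r x y].

Lemma alt_orbit_id : x \in alt_orbit.
Proof. by rewrite inE connect0. Qed.

Lemma alt_orbit_s y : (s y \in alt_orbit) = (y \in alt_orbit).
Proof.
suff S z : z \in alt_orbit -> s z \in alt_orbit by apply/idP/idP => /S; rewrite ?sK.
by rewrite !inE => /iter_findex <-; apply: fconnect_of_iter (iter_s _).
Qed.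

Lemma alt_orbit_t y : (t y \in alt_orbit) = (y \in alt_orbit).
Proof.
suff S z : z \in alt_orbit -> t z \in alt_orbit by apply/idP/idP => /S; rewrite ?tK.
by rewrite !inE => /iter_findex <-; apply: fconnect_of_iter (t_iter _).
Qed.

Let iter_fix_dvd i : iter i r x = x -> order r x %| i.
Proof.
rewrite {1}(divn_eq i (order r x)) addnC iterD.
have -> : iter (i %/ order r x * order r x) r x = x.
  by elim: (i %/ _) => //= d IH; rewrite mulSn iterD IH iter_order.
move=> h; have lt := ltn_pmod i (order_gt0 r x).
have : findex r x (iter (i %% order r x) r x) = findex r x x by rewrite h.
by rewrite findex_iter // findex0 => /eqP.
Qed.

(* On the orbit of [x] under [s \o t], [s] and [t] act on exponents as
   [i |-> - i] and [i |-> - i - 1] modulo the order [m]; so a fixed point other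
   than [x] has [i = m./2]. *)
Lemma alt_orbit_fix_uniq y z :
  y \in alt_orbit -> z \in alt_orbit -> y != x -> z != x ->
  (s y == y) || (t y == y) -> (s z == z) || (t z == z) -> y = z.
Proof.
suff H w : w \in alt_orbit -> w != x -> (s w == w) || (t w == w) ->
    findex r x w = (order r x)./2.
  move=> yS zS yx zx fy fz.
  move: (yS) (zS); rewrite !inE => /iter_findex <- /iter_findex <-.
  by rewrite !H.
rewrite inE => wS wx; have lt := findex_max wS.
have ne0 : findex r x w != 0.
  by apply: contraNneq wx => e; rewrite -(iter_findex wS) e.
rewrite -{1 2 3 4}(iter_findex wS); move: (findex r x w) lt ne0 => i lt ne0.
case/orP => /eqP e.
  have := iter_s i; rewrite e -iterD => /iter_fix_dvd /dvdnP[].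
  by move: (order r x) lt => m lt [|[|d]]; nia.
have := t_iter i; rewrite e -iterD => /iter_fix_dvd /dvdnP[].
by move: (order r x) lt => m lt [|[|d]]; nia.
Qed.

End InvolutionPair.

(** * Partial proper edge colourings, Kempe swaps and Vizing fans *)

Section PartialColorings.
Set Implicit Arguments.
Unset Strict Implicit.

Variables (V : finType) (q : nat).
Implicit Types (f g : 'I_q -> V -> V) (a b c : 'I_q) (u v w x y z : V).

(* [f a u] is the other end of the edge of colour [a] at [u], and [f a u = u]
   when colour [a] is missing at [u]. *)
Definition pcol f :=
  (forall a, involutive (f a)) /\
  (forall a b u, f a u = f b u -> f a u != u -> a = b).

Definition pcol_edge f u v := (u != v) && [exists a, f a u == v].

Lemma pcol_edgeP f u v :
  reflect (u != v /\ exists a, f a u = v) (pcol_edge f u v).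
Proof.
apply: (iffP andP) => -[uv]; last by case=> a fa; split=> //; apply/existsP; exists a; apply/eqP.
by move=> /existsP[a /eqP fa]; split=> //; exists a.
Qed.

Definition pair_rel x y : rel V :=
  fun u v => ((u == x) && (v == y)) || ((u == y) && (v == x)).

(** Composing with the transposition adds the edge [xy] in colour [a] when both ends miss [a], and
    deletes it when it has colour [a]. *)
Definition toggle f a x y : 'I_q -> V -> V :=
  fun c u => if c == a then tperm x y (f c u) else f c u.

Lemma pcol_add f a x y : pcol f -> x != y -> f a x = x -> f a y = y ->
  ~~ pcol_edge f x y ->
  pcol (toggle f a x y) /\
  forall u v, pcol_edge (toggle f a x y) u v = pcol_edge f u v || pair_rel x y u v.
Proof.
move=> [fK fU] xy fx fy nE.
have nf b : f b x <> y.
  by move=> h; case/negP: nE; apply/pcol_edgeP; split=> //; exists b.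
have nf' b : f b y <> x by move=> h; apply: (nf b); rewrite -h fK.
have fax u : (f a u == x) = (u == x) by rewrite -{1}fx (can_eq (fK a)).
have fay u : (f a u == y) = (u == y) by rewrite -{1}fy (can_eq (fK a)).
have tE u : toggle f a x y a u = if u == x then y else if u == y then x else f a u.
  by rewrite /toggle eqxx permE /= fax fay.
have tN c u : c != a -> toggle f a x y c u = f c u by rewrite /toggle => /negPf ->.
split; first split.
- move=> c u; case: (eqVneq c a) => [->|ca]; last by rewrite !tN // fK.
  rewrite !tE; case: (eqVneq u x) => [->|ux]; first by rewrite eqxx eq_sym (negPf xy).
  case: (eqVneq u y) => [->|uy]; first by rewrite eqxx.
  by rewrite fax fay (negPf ux) (negPf uy) fK.
- move=> c d u.
  have aux c' : c' != a -> toggle f a x y a u = f c' u -> f c' u != u -> c' = a.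
    move=> c'a; rewrite tE; case: (eqVneq u x) => [->|ux]; first by move/esym/nf.
    case: (eqVneq u y) => [->|uy]; first by move/esym/nf'.
    by move/esym => h1 h2; apply: fU h2.
  case: (eqVneq c a) => [->|ca]; case: (eqVneq d a) => [->|da] //.
  + by rewrite (tN d) // => h1; rewrite h1 => /(aux d da h1) ->.
  + by rewrite (tN c) // => h1 h2; exact: (aux c ca (esym h1) h2).
  + by rewrite !tN //; exact: fU.
move=> u v; apply/pcol_edgeP/idP.
  move=> [uv [c]]; case: (eqVneq c a) => [->|ca].
    rewrite tE /pair_rel; case: (eqVneq u x) => [->|ux]; first by move=> ->; rewrite eqxx orbT.
    case: (eqVneq u y) => [->|uy]; first by move=> ->; rewrite eqxx !orbT.
    by move=> h; apply/orP; left; apply/pcol_edgeP; split=> //; exists a.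
  by rewrite tN // => h; apply/orP; left; apply/pcol_edgeP; split=> //; exists c.
case/orP => [/pcol_edgeP [uv [c h]]|]; last first.
  case/orP => /andP[/eqP -> /eqP ->]; first by split=> //; exists a; rewrite tE eqxx.
  by split; rewrite 1?eq_sym //; exists a; rewrite tE eqxx eq_sym (negPf xy).
split=> //; exists c; case: (eqVneq c a) => [ca|ca]; last by rewrite tN.
subst c; rewrite tE; case: (eqVneq u x) => [ux|ux].
  by move: uv; rewrite -h ux fx eqxx.
by case: (eqVneq u y) => [uy|//]; move: uv; rewrite -h uy fy eqxx.
Qed.

Lemma pcol_del f b x z : pcol f -> f b x = z -> x != z ->
  pcol (toggle f b x z) /\
  forall u v, pcol_edge (toggle f b x z) u v = pcol_edge f u v && ~~ pair_rel x z u v.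
Proof.
move=> [fK fU] fx xz; have fz : f b z = x by rewrite -fx fK.
have fbx u : (f b u == x) = (u == z) by rewrite -{1}fz (can_eq (fK b)).
have fbz u : (f b u == z) = (u == x) by rewrite -{1}fx (can_eq (fK b)).
have tE u : toggle f b x z b u = if (u == x) || (u == z) then u else f b u.
  rewrite /toggle eqxx permE /= fbx fbz.
  by have [->|_] := u =P z; rewrite ?eqxx ?orbT //; have [->|_] := u =P x; rewrite ?eqxx.
have tN c u : c != b -> toggle f b x z c u = f c u by rewrite /toggle => /negPf ->.
have tU c u : toggle f b x z c u != u -> toggle f b x z c u = f c u.
  case: (eqVneq c b) => [->|cb]; last by rewrite tN.
  by rewrite tE; case: ifP => //; rewrite eqxx.
split; first split.
- move=> c u; case: (eqVneq c b) => [->|cb]; last by rewrite !tN // fK.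
  rewrite (tE u); case: ifP => h; first by rewrite tE h.
  by rewrite tE fbx fbz orbC h fK.
- move=> c d u h hc; have hd : toggle f b x z d u != u by rewrite -h.
  by move: h (hc); rewrite (tU _ _ hc) (tU _ _ hd); exact: fU.
move=> u v; apply/pcol_edgeP/andP => [[uv [c h]]|[/pcol_edgeP [uv [c h]] np]].
  have tc : toggle f b x z c u != u by rewrite h eq_sym.
  have fc := tU _ _ tc; rewrite h in fc.
  split; first by apply/pcol_edgeP; split=> //; exists c.
  apply/negP => pr; have cb : c = b.
    apply: (fU c b u); last by rewrite -fc eq_sym.
    by rewrite -fc; case/orP: pr => /andP[/eqP -> /eqP ->]; rewrite ?fx ?fz.
  subst c; move: tc; rewrite tE; case: ifP; rewrite ?eqxx // => hn _.
  by case/orP: pr => /andP[/eqP eu /eqP ev]; rewrite eu eqxx ?orbT in hn.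
split=> //; exists c; case: (eqVneq c b) => [cb|cb]; last by rewrite tN.
subst c; rewrite tE; case: ifP => // /orP[] /eqP eu; subst u; case/negP: np;
  by rewrite /pair_rel -h ?fx ?fz !eqxx ?orbT.
Qed.

(** When [S] is closed under [f a] and [f b], a union of Kempe chains, both ends of an edge are
    recoloured together. *)
Definition kempe_swap f a b (S : {set V}) : 'I_q -> V -> V :=
  fun c u => f (if u \in S then tperm a b c else c) u.

Lemma pcol_kempe_swap f a b (S : {set V}) : pcol f ->
  (forall u, (f a u \in S) = (u \in S)) -> (forall u, (f b u \in S) = (u \in S)) ->
  pcol (kempe_swap f a b S) /\
  forall u v, pcol_edge (kempe_swap f a b S) u v = pcol_edge f u v.
Proof.
move=> [fK fU] aS bS; rewrite /kempe_swap; split; first split.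
- move=> c u /=; case: (tpermP a b c) => [->|->|/eqP ca /eqP cb].
  + by case uS: (u \in S); rewrite ?bS ?aS uS fK.
  + by case uS: (u \in S); rewrite ?bS ?aS uS fK.
  + by rewrite !if_same fK.
- by move=> c d u /fU h /h; case: ifP => // _ /perm_inj.
move=> u v; congr (_ && _); apply/existsP/existsP => -[c h].
  by eexists; exact: h.
by exists (if u \in S then tperm a b c else c); case: (u \in S); rewrite ?tpermK.
Qed.

(** The colour of [xv] is missing at [u], so it can be passed on to [xu]; [v != x] says that [c] is
    present at [x]. *)
Definition fan f x : rel V :=
  fun u v => (v != x) && [exists c, (f c u == u) && (f c x == v)].

Lemma fanP f x u v :
  reflect (v != x /\ exists2 c, f c u = u & f c x = v) (fan f x u v).
Proof.
apply: (iffP andP) => [[vx /existsP[c /andP[/eqP h1 /eqP h2]]]|[vx [c h1 h2]]].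
  by split=> //; exists c.
by split=> //; apply/existsP; exists c; rewrite h1 h2 !eqxx.
Qed.

(** Colours move one step back along a path without repetition: [xy] takes the colour of [xz], for
    [z] the next vertex, and [xz] becomes the uncoloured edge. At the last vertex, [a] fills the
    gap. *)
Lemma fan_shift f x y a w : pcol f -> x != y -> ~~ pcol_edge f x y ->
  connect (fan f x) y w -> f a x = x -> f a w = w ->
  exists2 g, pcol g &
    forall u v, pcol_edge g u v = pcol_edge f u v || pair_rel x y u v.
Proof.
move=> fP xy nE /connectP[p0 p0P ->]; case: (shortenP p0P) => p pP pU _ {p0 p0P}.
elim: p f y fP xy nE pP pU => [|z p IH] f y fP xy nE /=.
  move=> _ _ fax faw; have [gP gE] := pcol_add fP xy fax faw nE.
  by exists (toggle f a x y).
move=> /andP[/fanP[zx [b fby fbx]] pP] /andP[yzp zpU] fax faw.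
have zp : z \notin p by case/andP: zpU.
have [fK fU] := fP.
have xz : x != z by rewrite eq_sym.
have yz : y != z by move: yzp; rewrite inE negb_or => /andP[].
have ab : (a == b) = false.
  by apply/eqP => e; move: xz; rewrite -fbx -e fax eqxx.
have [f1P f1E] := pcol_del fP fbx xz; set f1 := toggle f b x z in f1P f1E.
have f1N c u : c != b -> f1 c u = f c u by rewrite /f1 /toggle => /negPf ->.
have f1x : f1 b x = x by rewrite /f1 /toggle eqxx fbx tpermR.
have f1y : f1 b y = y by rewrite /f1 /toggle eqxx fby tpermD // eq_sym.
have nE1 : ~~ pcol_edge f1 x y by rewrite f1E negb_and nE.
have [f2P f2E] := pcol_add f1P xy f1x f1y nE1; set f2 := toggle f1 b x y in f2P f2E.
have f2N c u : c != b -> f2 c u = f c u.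
  by move=> cb; rewrite -f1N // /f2 /toggle (negPf cb).
have nE2 : ~~ pcol_edge f2 x z.
  by rewrite f2E f1E /pair_rel !eqxx /= andbF (eq_sym z y) (negPf yz) (negPf xy).
(* Only colour [b] has changed, and at [x] it led to [z], which the rest of the path avoids. *)
have path2 r u : path (fan f x) u r -> z \notin r -> path (fan f2 x) u r.
  elim: r u => //= v r IHr u /andP[/fanP[vx [c fcu fcx]] rP].
  rewrite inE negb_or => /andP[zv zr]; rewrite IHr // andbT; apply/fanP; split=> //.
  have cb : c != b by apply: contraNneq zv => cb; rewrite -fcx cb fbx.
  by exists c; rewrite f2N.
have [||g gP gE] := IH f2 z f2P xz nE2 (path2 _ _ pP zp) zpU.
- by rewrite f2N ?ab.
- by rewrite f2N ?ab.
exists g => // u v; rewrite gE f2E f1E.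
have xzE : pair_rel x z u v -> pcol_edge f u v.
  case/orP => /andP[/eqP -> /eqP ->]; apply/pcol_edgeP; split=> //; exists b => //.
  by rewrite -fbx fK.
by move: xzE; case: (pair_rel x z u v) => [->|_]; rewrite /= ?andbT ?orbT ?orbF.
Qed.

(* The Kempe swap turns the first vertex of the fan path which lies in [S] and
   misses [b] into one missing [a], and keeps the path up to it valid. *)
Lemma fan_kempe_swap f x y a b (S : {set V}) z : f a x = x -> x \notin S ->
  connect (fan f x) y z -> z \in S -> f b z = z ->
  exists2 w, connect (fan (kempe_swap f a b S) x) y w &
    kempe_swap f a b S a w = w.
Proof.
move=> fax xS /connectP[p pP ->].
set g := kempe_swap f a b S.
have here u : u \in S -> f b u = u -> g a u = u.
  by rewrite /g /kempe_swap => -> h; rewrite tpermL.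
elim: p y pP => [|v p IH] u /=; first by move=> _ uS fu; exists u => //; exact: here.
move=> /andP[/fanP[vx [c fcu fcx]] pP] lS fl.
case: (boolP ((u \in S) && (f b u == u))) => [/andP[uS /eqP fu]|h].
  by exists u => //; exact: here.
have [w cw gw] := IH v pP lS fl; exists w => //; apply: connect_trans cw.
apply: connect1; apply/fanP; split=> //; exists c; last first.
  by rewrite /g /kempe_swap (negPf xS).
rewrite /g /kempe_swap; case: ifP => uS //.
have ca : a != c by apply: contraNneq vx => e; rewrite -fcx -e fax.
have cb : b != c by apply: contraNneq h => e; rewrite uS e fcu eqxx.
by rewrite tpermD.
Qed.

(* If no vertex reached by the fan from [y] shares a missing colour with [x], then
   mapping a reached vertex to the other end of the edge at [x] in one of its
   missing colours sends the reached set into itself minus [y]; two vertices with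
   the same image miss a common colour, and one of them is off the Kempe chain
   of [x]. *)
Lemma fan_extend f x y : pcol f -> x != y -> ~~ pcol_edge f x y ->
  (exists a, f a x = x) -> (exists a, f a y = y) ->
  (forall z, pcol_edge f x z -> exists a, f a z = z) ->
  exists2 g, pcol g &
    forall u v, pcol_edge g u v = pcol_edge f u v || pair_rel x y u v.
Proof.
move=> fP xy nE [a fax] [a0 fy] nbr; have [fK fU] := fP.
pose Y := [set z | connect (fan f x) y z].
have yY : y \in Y by rewrite inE connect0.
have miss z : z \in Y -> exists b, f b z == z.
  rewrite inE => /connectP[p]; case: (lastP p) => [|p' v].
    by move=> _ ->; exists a0; rewrite fy.
  rewrite rcons_path last_rcons => /andP[_ /fanP[vx [c _ fcx]]] ->.
  have [|b fb] := nbr v; last by exists b; rewrite fb.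
  by apply/pcol_edgeP; split; [rewrite eq_sym | exists c].
pose m z := odflt a [pick b | f b z == z].
have mP z : z \in Y -> f (m z) z = z.
  by rewrite /m => /miss [b hb]; case: pickP => [c /eqP|/(_ b)] //=; rewrite hb.
case: (boolP [exists z in Y, f (m z) x == x]) => [/exists_inP[z zY /eqP fz]|].
  by move: (zY); rewrite inE => cz; apply: (fan_shift fP xy nE cz fz); exact: mP.
rewrite negb_exists_in => /forall_inP noX.
have sub : [set f (m z) x | z in Y] \subset Y :\ y.
  apply/subsetP => v /imsetP[z zY ->]; rewrite !inE; apply/andP; split.
    apply: contraNneq nE => e; apply/pcol_edgeP; split=> //; by exists (m z).
  move: (zY); rewrite inE => cz; apply: connect_trans cz (connect1 _).
  by apply/fanP; split; [exact: noX | exists (m z) => //; exact: mP].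
have /dinjectivePn [z1 z1Y [z2]] : ~~ dinjectiveb (fun z => f (m z) x) Y.
  apply/negP => /dinjectiveP inj; have := subset_leq_card sub.
  by rewrite card_in_imset // (cardsD1 y Y) yY ltnn.
rewrite inE => /andP[ne12 z2Y] e12.
have eb : m z1 = m z2 by apply: (fU _ _ _ e12); exact: noX.
move: (m z1) eb (mP _ z1Y) (mP _ z2Y) (noX _ z1Y) => b <- fb1 fb2 fbx.
pose S := alt_orbit (f a) (f b) x.
have Sa u : (f a u \in S) = (u \in S) by apply: alt_orbit_s.
have Sb u : (f b u \in S) = (u \in S) by apply: alt_orbit_t.
have zx z : f b z = z -> z != x by move=> h; apply: contraNneq fbx => <-; rewrite h.
(* The chain of [x] has at most one other end, so it cannot contain both [z1] and [z2]. *)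
have [z [zY fbz zS]] : exists z, [/\ z \in Y, f b z = z & z \notin S].
  case: (boolP (z1 \in S)) => [z1S|]; last by exists z1.
  case: (boolP (z2 \in S)) => [z2S|]; last by exists z2.
  case/eqP: ne12; apply/esym; apply: (@alt_orbit_fix_uniq _ (f a) (f b) x) => //.
  - exact: zx.
  - exact: zx.
  - by rewrite fb1 eqxx orbT.
  - by rewrite fb2 eqxx orbT.
(* Swapping off the chain of [x] leaves [x] missing [a]. *)
have xS : x \notin ~: S by rewrite inE negbK alt_orbit_id.
move: zY; rewrite inE => cz.
have zS' : z \in ~: S by rewrite inE.
have [w cw gw] := fan_kempe_swap fax xS cz zS' fbz.
have [|u|gP gE] := @pcol_kempe_swap f a b (~: S) fP.
- by move=> u; rewrite !inE; congr (~~ _); have := Sa u; rewrite !inE.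
- by rewrite !inE; congr (~~ _); have := Sb u; rewrite !inE.
have [||h hP hE] := fan_shift gP xy _ cw _ gw.
- by rewrite gE.
- by rewrite /kempe_swap (negPf xS).
by exists h => // u v; rewrite hE gE.
Qed.

(** * Vizing's argument when the vertices of degree [q] are independent *)

Lemma missing_color f u : pcol f -> #|pcol_edge f u| < q -> exists a, f a u = u.
Proof.
move=> [fK fU] lt; case: (boolP [exists a, f a u == u]) => [|/existsPn h].
  by case/existsP=> a /eqP; exists a.
have inj : injective (fun a => f a u) by move=> a b e; exact: fU e (h a).
have /subset_leq_card : codom (fun a => f a u) \subset pcol_edge f u.
  apply/subsetP => v /codomP[a ->]; apply/pcol_edgeP.
  by split; [rewrite eq_sym; exact: h | exists a].
by rewrite card_codom // card_ord leqNgt lt.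
Qed.

(** Induction on the number of edges: [xy] is deleted, the rest coloured, and [xy] restored by
    [fan_extend]. The deletion frees a colour at [x] and [y]; the other neighbours of [x] have
    degree below [q]. *)
Theorem vizing_core_independent (e : rel V) :
  symmetric e -> irreflexive e -> (forall u, #|e u| <= q) ->
  (forall u v, e u v -> (#|e u| < q) || (#|e v| < q)) ->
  exists2 f, pcol f & forall u v, pcol_edge f u v = e u v.
Proof.
move: {2}#|_|.+1 (ltnSn #|[set p : V * V | e p.1 p.2]|) => n.
elim: n e => // n IH e le e_sym e_irr deg core.
case: (pickP (fun p : V * V => e p.1 p.2)) => [[x0 y0] /= e0|noE]; last first.
  exists (fun _ => id); first by split=> // a b u _; rewrite eqxx.
  move=> u v; rewrite (noE (u, v)); apply/pcol_edgeP => -[uv [a uv']].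
  by rewrite uv' eqxx in uv.
(* The centre of the fan is taken of degree [q] if possible, so that its
   neighbours have smaller degree. *)
have [x [y [exy nbr]]] : exists x y, e x y /\ forall z, e x z -> #|e z| < q.
  have [/existsP[x /andP[/eqP dx /existsP[y exy]]]|/existsPn noM] :=
      boolP [exists x, (#|e x| == q) && [exists y, e x y]].
    exists x, y; split=> // z /core; by rewrite dx ltnn.
  exists x0, y0; split=> // z ez; rewrite ltn_neqAle deg andbT.
  apply: contraNneq (noM z) => ->; rewrite eqxx; apply/existsP.
  by exists x0; rewrite e_sym.
have xy : x != y by apply: contraTneq exy => ->; rewrite e_irr.
pose e1 u v := e u v && ~~ pair_rel x y u v.
have e1sub u : {subset e1 u <= e u} by move=> v /andP[].
have deg1 u : #|e1 u| <= #|e u| by apply/subset_leq_card/subsetP/e1sub.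
have pairC u v : pair_rel x y u v = pair_rel x y v u.
  by rewrite /pair_rel orbC; congr (_ || _); rewrite andbC.
have deg1_lt u v : pair_rel x y u v -> e u v -> #|e1 u| < #|e u|.
  move=> puv euv; apply/proper_card/properP; split; first exact/subsetP/e1sub.
  by exists v => //; rewrite /in_mem /= /e1 puv andbF.
have pxy : pair_rel x y x y by rewrite /pair_rel !eqxx.
have [|||||f fP fE] := IH e1.
- rewrite ltnS in le; apply: leq_trans le; apply/proper_card/properP; split.
    by apply/subsetP => p; rewrite !inE => /andP[].
  by exists (x, y); rewrite !inE //= /e1 pxy andbF.
- by move=> u v; rewrite /e1 e_sym pairC.
- by move=> u; rewrite /e1 e_irr.
- by move=> u; apply: leq_trans (deg u).
- move=> u v /andP[/core + _].
  by case/orP => h; rewrite (leq_ltn_trans (deg1 _) h) ?orbT.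
have missing u : #|e1 u| < q -> exists a, f a u = u.
  by move=> lt; apply: missing_color; rewrite // (eq_card (B := e1 u)) // => v; exact: fE.
have [|||z|g gP gE] := fan_extend fP xy.
- by rewrite fE /e1 pxy andbF.
- by apply: missing; apply: leq_trans (deg x); exact: deg1_lt exy.
- by apply: missing; apply: leq_trans (deg y); apply: (deg1_lt _ x); rewrite 1?pairC 1?e_sym.
- by rewrite fE => /andP[/nbr h _]; apply: missing; apply: leq_ltn_trans h.
exists g => // u v; rewrite gE fE /e1.
case: (boolP (pair_rel x y u v)) => [|_]; rewrite ?orbF ?andbT // orbT.
by case/orP => /andP[/eqP -> /eqP ->]; rewrite // e_sym.
Qed.

End PartialColorings.

(** * Edge cuts and stars *)

Section Pairs.
Set Implicit Arguments.
Unset Strict Implicit.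

Lemma set2_crossing_inj (T : finType) (A : {set T}) u v u' v' :
  u \in A -> v \notin A -> u' \in A -> v' \notin A ->
  [set u; v] = [set u'; v'] -> (u, v) = (u', v').
Proof.
move=> uA vA uA' vA' e; congr pair.
  have := set21 u v; rewrite e in_set2 => /orP[/eqP //|/eqP h].
  by rewrite h (negPf vA') in uA.
have := set22 u v; rewrite e in_set2 => /orP[/eqP h|/eqP //].
by rewrite h uA' in vA.
Qed.

Lemma set2_inj (T : finType) (u v w : T) : [set u; v] = [set u; w] -> v = w.
Proof.
move=> e; have := set22 u v; rewrite e in_set2 => /orP[/eqP h|/eqP //].
by have := set22 u w; rewrite -e h !in_set2 orbb => /eqP.
Qed.

End Pairs.

Section Graph.
Set Implicit Arguments.
Unset Strict Implicit.

Variable G : sgraph.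
Implicit Types (u v w : G) (F : {set edge G}).

Lemma edge_setP u v : adj u v -> [set u; v] \in edge_set G.
Proof. by move=> uv; apply/imsetP; exists (u, v). Qed.

Lemma edge_of u v : adj u v -> {f : edge G | val f = [set u; v]}.
Proof. by move=> uv; exists (Sub [set u; v] (edge_setP uv) : edge G). Qed.

Lemma del_adj_sym F : symmetric (del_adj F).
Proof. by move=> u v; rewrite /del_adj adj_sym setUC. Qed.

Lemma edge_cut_sym u v F : edge_cut u v F = edge_cut v u F.
Proof. by rewrite /edge_cut (sym_connect_sym (del_adj_sym F)). Qed.

Lemma min_edge_cut_sym u v F : min_edge_cut u v F = min_edge_cut v u F.
Proof.
rewrite /min_edge_cut edge_cut_sym; congr (_ && _).
by apply: eq_forallb => F'; rewrite edge_cut_sym.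
Qed.

(** For [A] the component of [u] in [G - F], every edge leaving [A] lies in [F]. One crossing edge
    [h w] for each [w] in [D] stands in for a system of edge-disjoint paths. *)
Lemma edge_cut_leq u v F (D : {set G}) :
  edge_cut u v F ->
  (forall A : {set G}, u \in A -> v \notin A ->
    exists2 h : G -> G * G, {in D &, injective h} &
      forall w, w \in D -> [/\ (h w).1 \in A, (h w).2 \notin A & adj (h w).1 (h w).2]) ->
  #|D| <= #|F|.
Proof.
pose A := [set w | connect (del_adj F) u w].
move=> cut /(_ A) []; rewrite ?inE ?connect0 // => h inj hP.
have inj' : {in D &, injective (fun w => [set (h w).1; (h w).2])}.
  move=> w w' wD wD' /= e; apply: inj => //.
  have [h1 h2 _] := hP _ wD; have [h1' h2' _] := hP _ wD'.
  have := set2_crossing_inj h1 h2 h1' h2' e.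
  by rewrite -!surjective_pairing.
rewrite -(card_in_imset inj') -(card_imset F val_inj).
apply/subset_leq_card/subsetP => _ /imsetP[w wD ->].
have [+ + a] := hP _ wD; rewrite !inE => h1; apply: contraNT => nF.
by apply: connect_trans h1 (connect1 _); rewrite /del_adj a nF.
Qed.

Definition star v : {set edge G} := [set f : edge G | v \in val f].

Lemma starP v f : f \in star v -> exists2 w, adj v w & val f = [set v; w].
Proof.
rewrite inE; have /imsetP[[a b] /= ab ->] := valP f.
rewrite in_set2 => /orP[]/eqP ->; first by exists b.
by exists a; rewrite 1?adj_sym // setUC.
Qed.

Lemma card_star v : #|star v| <= #|[set w | adj v w]|.
Proof.
rewrite -(card_imset (star v) val_inj).
apply: leq_trans (leq_imset_card (fun w => [set v; w]) _).
apply/subset_leq_card/subsetP => _ /imsetP[f /starP[w vw ->] ->].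
by apply/imsetP; exists w; rewrite ?inE.
Qed.

Lemma edge_cut_star u v : u != v -> edge_cut u v (star v).
Proof.
move=> uv; rewrite edge_cut_sym; apply/negP => /connectP[[|w p] /=].
  by move=> _ e; rewrite e eqxx in uv.
move=> /andP[/andP[vw /negP + _] _]; apply; have [f fE] := edge_of vw.
by apply/imsetP; exists f; rewrite ?inE fE // set21.
Qed.

Lemma rainbow_card q (c : {ffun edge G -> 'I_q}) F : rainbow c F -> #|F| <= q.
Proof.
move=> /forall_inP rb; rewrite -[X in _ <= X]card_ord -(@card_in_imset _ _ c F) ?max_card //.
move=> f g fF gF e; apply: contraTeq isT => ne.
by have /forall_inP /(_ g gF) := rb f fF; rewrite ne e eqxx.
Qed.

(* The default [d] is never used: every edge is a pair. *)
Definition edge_coloring q (d : 'I_q) (col : G -> G -> 'I_q) : {ffun edge G -> 'I_q} :=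
  [ffun f => if [pick p : G * G | val f == [set p.1; p.2]] is Some p
             then col p.1 p.2 else d].

Lemma edge_coloringE q (d : 'I_q) col f u v : (forall x y, col x y = col y x) ->
  val f = [set u; v] -> edge_coloring d col f = col u v.
Proof.
move=> colC fE; rewrite ffunE; case: pickP => [[x y] /= /eqP|/(_ (u, v))]; last first.
  by rewrite fE eqxx.
rewrite fE => e; have := set21 u v; rewrite {1}e in_set2 => /orP[]/eqP ux.
  by rewrite -ux in e *; rewrite (set2_inj e).
by move: e; rewrite (setUC [set x]) -ux => /set2_inj ->; exact: colC.
Qed.

End Graph.

(** * Complete multipartite graphs *)

Section Multipartite.
Set Implicit Arguments.
Unset Strict Implicit.

Variables (k : nat) (n : 'I_k -> nat).
Let G := complete_multipartite n.
Let N := \sum_(i < k) n i.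
Implicit Types (u v w : G) (i j : 'I_k).

Lemma adjE u v : adj u v = (tag u != tag v).
Proof. by []. Qed.

Lemma card_part i : #|[set u : G | tag u == i]| = n i.
Proof.
rewrite -[RHS]card_ord -cardsT.
rewrite -(card_imset _ (@eq_from_Tagged _ (fun i => 'I_(n i)) i)).
apply: eq_card => u; rewrite inE; apply/eqP/imsetP => [ui|[x _ ->]] //.
by case: u ui => j x /= e; subst j; exists x.
Qed.

Lemma card_adj u : #|[set w : G | adj u w]| = N - n (tag u).
Proof.
have <- : #|G| = N.
  rewrite -sum1_card (partition_big (fun u : G => tag u) xpredT) //=.
  by apply: eq_bigr => i _; rewrite sum1dep_card card_part.
rewrite -(card_part (tag u)) -(cardsC [set w : G | tag w == tag u]) addKn.
by apply: eq_card => w; rewrite !inE adjE eq_sym.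
Qed.

Lemma vertex_eq u v : tag u = tag v -> (tagged u = tagged v :> nat) -> u = v.
Proof.
by case: u v => i x [j y] /= e; subst j => /val_inj ->.
Qed.

(** Each vertex keeps its index in the new part, then a transposition moves the image of [u] to [v].
    The default of [insubd] is not reached on the part of [u]. *)
Lemma part_embedding u v : n (tag u) <= n (tag v) ->
  exists s : G -> G, [/\ s u = v,
    {in [pred w | tag w == tag u] &, injective s} &
    forall w, tag (s w) = tag v].
Proof.
move=> le.
pose s0 w : G := Tagged (fun i => 'I_(n i)) (insubd (tagged v) (tagged w : nat)).
have s0E w : tag w = tag u -> (tagged (s0 w) = tagged w :> nat).
  move=> wu; rewrite /s0 /= insubdK //.
  by apply: leq_trans le; rewrite -wu; exact: ltn_ord.
exists (fun w => tperm (s0 u) v (s0 w)); split; first exact: tpermL.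
  move=> w w' /eqP wu /eqP wu' /perm_inj e; apply: vertex_eq; first by rewrite wu.
  by rewrite -(s0E w) // e s0E.
by move=> w; case: tpermP => // [_|->].
Qed.

(* For [w] adjacent to [v], some edge of the path [u - v], [u - w - v] or
   [u - s w - w - v] leaves [A]; these paths are edge-disjoint, and the crossing
   edge is returned as a pair (inside, outside), which determines [w]. *)
Lemma edge_cut_adj u v (F : {set edge G}) : n (tag u) <= n (tag v) ->
  edge_cut u v F -> N - n (tag v) <= #|F|.
Proof.
move=> le cut; rewrite -card_adj; apply: edge_cut_leq cut _ => A uA vA.
have [s [su sinj st]] := part_embedding le.
pose h w : G * G := if w \in A then (w, v) else if tag w != tag u then (u, w)
  else if s w \in A then (s w, w) else (u, s w).
exists h => [w w'|w]; rewrite !inE !adjE; last first.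
  move=> vw; rewrite /h; case: ifP => wA /=; first by rewrite wA vA eq_sym.
  case: ifP => wu /=; first by rewrite uA wA eq_sym.
  move/eqP: wu => wu; case: ifP => swA /=; first by rewrite swA wA st.
  by rewrite uA swA st -wu eq_sym.
(* In the part of [u], only [u] is sent to [v] by [s], and [u] is in [A]. *)
have hv w0 : tag v != tag w0 -> (h w0).2 = v -> w0 \in A.
  move=> vw; rewrite /h; case: ifP => //= wA; case: ifP => wu /=.
    by move=> e; rewrite e eqxx in vw.
  move/eqP: wu => wu; case: ifP => swA /= e; first by rewrite e eqxx in vw.
  by rewrite -wA (sinj w0 u) ?inE ?wu ?su // uA.
move=> vw vw' e; case: (boolP (w \in A)) => wA.
  have w'A : w' \in A by apply: hv; rewrite // -e /h wA.
  by move: e; rewrite /h wA w'A => -[].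
have w'A : w' \notin A.
  by apply: contraNN wA => w'A; apply: hv; rewrite // e /h w'A.
move: e; rewrite /h (negPf wA) (negPf w'A).
have tsep x y : tag x != tag y -> x = y -> w = w' by move=> xy h'; rewrite h' eqxx in xy.
case: (boolP (tag w == tag u)) => wu /=; case: (boolP (tag w' == tag u)) => wu' /=.
- case: ifP => _; case: ifP => _ [] //.
  + by move=> _; apply: tsep; rewrite st eq_sym.
  + by move=> _; apply: tsep; rewrite st.
  + by apply: sinj.
- by case: ifP => _ [] //; apply: tsep; rewrite st.
- by case: ifP => _ [] //; apply: tsep; rewrite st eq_sym.
- by case.
Qed.

(** * Lower and upper bounds for the number of colours *)

Lemma srd_colorable_leq u v q : u != v -> n (tag u) <= n (tag v) ->
  srd_colorable G q -> N - n (tag v) <= q.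
Proof.
move=> uv le /existsP[c /forallP /(_ u) /forallP /(_ v)].
rewrite uv => /existsP[F /andP[/andP[cut _] /rainbow_card]].
exact: leq_trans (edge_cut_adj le cut).
Qed.

Lemma min_edge_cut_star u v : u != v -> n (tag u) <= n (tag v) ->
  min_edge_cut u v (star v).
Proof.
move=> uv le; rewrite /min_edge_cut edge_cut_star //=.
apply/forallP => F; apply/implyP => /(edge_cut_adj le); apply: leq_trans.
by rewrite -card_adj; exact: card_star.
Qed.

(** Of two distinct vertices, one differs from [x] and lies in a part at least as large as that of
    the other, the part of [x] being smallest; its star is a rainbow minimum cut. *)
Lemma proper_off_vertex_srd_colorable q (c : {ffun edge G -> 'I_q}) (x : G) :
  (forall i, n (tag x) <= n i) -> (forall v, v != x -> rainbow c (star v)) ->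
  strong_rainbow_disconnected c.
Proof.
move=> xmin rb; apply/forallP => u; apply/forallP => v; apply/implyP => uv.
wlog: u v uv / (v != x) && (n (tag u) <= n (tag v)).
  move=> H; case: (boolP ((v != x) && (n (tag u) <= n (tag v)))) => [|h]; first exact: H.
  have /existsP[F FP] : [exists F, min_edge_cut v u F && rainbow c F].
    apply: H; first by rewrite eq_sym.
    move: h; rewrite negb_and negbK => /orP[/eqP vx|]; first by rewrite vx xmin -vx uv.
    rewrite -ltnNge => lt; rewrite (ltnW lt) andbT.
    by apply: contraTneq lt => ->; rewrite -leqNgt xmin.
  by apply/existsP; exists F; rewrite min_edge_cut_sym.
case/andP=> vx le; apply/existsP; exists (star v).
by rewrite min_edge_cut_star // rb.
Qed.

(** [N - n i] is the degree in part [i]. The last bound is conditional because a part reduced to [x]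
    leaves no vertex in [G - x]. *)
Lemma srd_colorable_of_degrees (x : G) q : 0 < q ->
  (forall i, n (tag x) <= n i) ->
  (forall i, i != tag x -> N - n i <= q) ->
  (1 < n (tag x) -> N - n (tag x) <= q) ->
  srd_colorable G q.
Proof.
move=> q_gt0 xmin deg_far deg_near.
pose e : rel G := fun u v => [&& adj u v, u != x & v != x].
have e_sym : symmetric e.
  by move=> u v; rewrite /e adj_sym; congr (_ && _); rewrite andbC.
have e_irr : irreflexive e by move=> u; rewrite /e adj_irr.
have sub u : e u \subset [set w | adj u w] by apply/subsetP => v /and3P[]; rewrite inE.
have far u : tag u != tag x -> #|e u| < q.
  move=> ux; apply: leq_trans (deg_far _ ux); rewrite -card_adj.
  apply/proper_card/properP; split; first exact: sub.
  by exists x; rewrite ?inE // /in_mem /= /e eqxx !andbF.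
have [u|u v /and3P[uv _ _]|f fP fE] := @vizing_core_independent _ q e e_sym e_irr.
- case: (boolP (tag u == tag x)) => [/eqP ux|/far/ltnW //].
  case: (eqVneq u x) => [->|ux'].
    by rewrite (eq_card0 (A := e x)) // => v; rewrite /in_mem /= /e eqxx !andbF.
  apply: leq_trans (subset_leq_card (sub u)) _; rewrite card_adj ux deg_near //.
  rewrite -card_part; apply: leq_trans (_ : #|[set u; x]| <= _).
    by rewrite cards2 ux'.
  by apply/subset_leq_card/subsetP => w; rewrite in_set2 inE => /orP[]/eqP ->; rewrite ?ux.
- case: (boolP (tag u == tag x)) => [/eqP ux|/far -> //].
  by rewrite (far v) ?orbT // -ux eq_sym.
pose d : 'I_q := Ordinal q_gt0.
pose m v := odflt d [pick a | f a v == v].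
have mP v : adj x v -> f (m v) v = v.
  move=> xv; rewrite /m; case: pickP => [a /eqP //|no].
  have [|a fa] := @missing_color _ _ f v fP; last by have := no a; rewrite fa eqxx.
  by rewrite (eq_card (B := e v)) ?far // 1?eq_sym // => w; exact: fE.
pose col u v := if u == x then m v else if v == x then m u else
  odflt d [pick a | f a u == v].
have [fK fU] := fP.
have colC u v : col u v = col v u.
  rewrite /col; case: (eqVneq u x) => [->|ux]; first by case: eqVneq => [->|].
  case: (eqVneq v x) => // _; congr odflt; apply: eq_pick => a.
  by apply/eqP/eqP => <-; rewrite fK.
have colP u v : adj u v -> u != x -> v != x -> f (col u v) u = v.
  move=> uv ux vx; rewrite /col (negPf ux) (negPf vx).
  have : e u v by rewrite /e uv ux.
  rewrite -fE => /pcol_edgeP[_ [a fa]].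
  by case: pickP => [b /eqP //|/(_ a)]; rewrite fa eqxx.
apply/existsP; exists (edge_coloring d col).
apply: (@proper_off_vertex_srd_colorable _ _ x) => // v vx.
apply/forall_inP => g /starP[w vw gE]; apply/forall_inP => g' /starP[w' vw' gE'].
apply/implyP; apply: contraNN => /eqP.
rewrite (edge_coloringE _ colC gE) (edge_coloringE _ colC gE') => ew.
suff -> : g = g' by [].
apply: val_inj; rewrite gE gE'; congr [set _; _].
(* The colour [m v] of [vx] is missing at [v] in [G - x], so no other edge at [v] carries it. *)
have cx w0 : col v x = col v w0 -> adj v w0 -> adj v x -> w0 = x.
  move=> h vw0 vx'; apply/eqP/negPn/negP => w0x.
  have := colP v w0 vw0 vx w0x; rewrite -h /col (negPf vx) eqxx mP 1?adj_sym //.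
  by move=> vw0'; rewrite -vw0' adj_irr in vw0.
case: (eqVneq w x) => [wx|wx]; first by subst w; exact: esym (cx w' ew vw' vw).
case: (eqVneq w' x) => [wx'|wx']; first by subst w'; exact: (cx w (esym ew) vw vw').
by rewrite -(colP v w) // ew colP.
Qed.

Lemma srd_eq q : srd_colorable G q -> (forall q', srd_colorable G q' -> q <= q') ->
  srd G = q.
Proof.
move=> cq minq; rewrite /srd; case: ex_minnP => m cm mmin.
by apply/eqP; rewrite eqn_leq mmin // minq.
Qed.

End Multipartite.

Theorem theorem3p7 (k : nat) (n : 'I_k -> nat) (hk : 2 <= k)
    (n_gt0 : forall i : 'I_k, 0 < n i)
    (n_mono : forall i j : 'I_k, i <= j -> n i <= n j) :
  let G := complete_multipartite n in
  let N := \sum_(i < k) n i in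
  let n1 := n (Ordinal (ltnW hk)) in
  let n2 := n (Ordinal hk) in
  (n1 = 1 -> srd G = N - n2) /\ (2 <= n1 -> srd G = N - n1).
Proof.
move=> G N n1 n2.
set i1 := Ordinal (ltnW hk) in n1 *; set i2 := Ordinal hk in n2 *.
pose x : G := Tagged (fun i => 'I_(n i)) (Ordinal (n_gt0 i1)).
have i21 : i2 != i1 by [].
have xmin i : n (tag x) <= n i by apply: n_mono.
have far i : i != i1 -> n2 <= n i.
  by move=> ii; apply: n_mono; rewrite lt0n; apply: contraNneq ii => h; apply/eqP/val_inj.
have Nle : n1 + n2 <= N.
  rewrite /N (bigD1 i1) //= leq_add2l (bigD1 i2) //=; exact: leq_addr.
have n1_gt0 : 0 < n1 := n_gt0 i1.
have n2_gt0 : 0 < n2 := n_gt0 i2.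
split=> h; apply: srd_eq.
- apply: (@srd_colorable_of_degrees _ _ x) => //=.
  + by rewrite subn_gt0; apply: leq_trans Nle; rewrite -add1n leq_add2r.
  + by move=> i /far le; exact: leq_sub2l.
  (* The smallest part is [x] alone, so the bound inside it is vacuous. *)
  + by rewrite -/n1 h.
- pose y : G := Tagged (fun i => 'I_(n i)) (Ordinal (n_gt0 i2)).
  move=> q; apply: (@srd_colorable_leq _ _ x y); last exact: xmin.
  by apply/eqP => /(congr1 (fun u : G => val (tag u))).
- apply: (@srd_colorable_of_degrees _ _ x) => //=.
  + by rewrite subn_gt0; apply: leq_trans Nle; rewrite -addn1 leq_add2l.
  + by move=> i _; apply: leq_sub2l; exact: xmin.
(* [h] makes index 1 valid: [y] is the second vertex of the smallest part. *)
- pose y : G := Tagged (fun i => 'I_(n i)) (Ordinal h).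
  move=> q; apply: (@srd_colorable_leq _ _ x y) => //.
  by apply/eqP => /eqP; rewrite eq_Tagged.
Qed.
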